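(* Assume the Ultrapower Axiom. Then Ultrafilter Determinacy holds, i.e. the Lipschitz order on \(\mathrm{Un}\) is linear; in fact, the Lipschitz order on \(\mathrm{Un}\) is equal to the seed order on \(\mathrm{Un}\).
   Context: A uniform ultrafilter on an ordinal \(\alpha\) is an ultrafilter on \(\alpha\) containing \(\alpha\setminus\beta\) for all \(\beta<\alpha\); its space \(\mathrm{sp}(U)\) is \(\alpha\). \(\mathrm{Un}\) is the class of countably complete uniform ultrafilters on ordinals. For a countably complete ultrafilter \(U\), \(j_U:V\to M_U\) is the ultrapower embedding into the transitive collapse and \([\mathrm{id}]_U\) the element represented by the identity. An elementary embedding \(i:M\to N\) between transitive inner models is an internal ultrapower embedding if it is the ultrapower of \(M\) (using functions in \(M\)) by an \(M\)-ultrafilter belonging to \(M\). A comparison of \((j_{U_0},j_{U_1})\) is a pair of internal ultrapower embeddings \(i_0:M_{U_0}\to N\), \(i_1:M_{U_1}\to N\) with \(i_0\circ j_{U_0}=i_1\circ j_{U_1}\). The Ultrapower Axiom says every pair \((j_{U_0},j_{U_1})\) with \(U_0,U_1\) countably complete ultrafilters admits a comparison. Seed order: \(U_0<_S U_1\) iff some comparison \((i_0,i_1)\) of \((j_{U_0},j_{U_1})\) has \(i_0([\mathrm{id}]_{U_0})<i_1([\mathrm{id}]_{U_1})\). A function \(f:P(\delta)\to P(\delta)\) is strongly Lipschitz if for all \(X\subseteq\delta\), \(\alpha\in f(X)\) iff \(\alpha\in f(X\cap\alpha)\); for \(A,B\subseteq P(\delta)\), \(A<_L B\) iff \(A=f^{-1}[B]\)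 for some strongly Lipschitz \(f\). Lipschitz order on \(\mathrm{Un}\): \(U<_L W\) iff \(U'<_L W'\) in the Lipschitz order on \(P(P(\delta))\), where \(\delta=\max\{\mathrm{sp}(U),\mathrm{sp}(W)\}\), \(U'=\{X\subseteq\delta: X\cap\mathrm{sp}(U)\in U\}\), \(W'=\{X\subseteq\delta: X\cap\mathrm{sp}(W)\in W\}\). Ultrafilter Determinacy is the statement that the Lipschitz order on \(\mathrm{Un}\) is linear (any two distinct elements are comparable). *)

(* Defs.v *)
(* The background theory is first-order ZFC.  The universe of sets is an
   arbitrary first-order structure satisfying the ZFC axioms, with the Separation
   and Replacement schemas taken over a deep embedding of the formulas of the
   language of set theory.  Everything below is meant internally to that universe:
   "function", "countable", "ordinal" refer to elements of the structure. *)

Set Implicit Arguments.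
Unset Strict Implicit.
Unset Printing Implicit Defensive.

Record structure : Type := Structure {
  dom :> Type;
  mem : dom -> dom -> Prop
}.

Notation "x ∈ y" := (mem x y) (at level 70, no associativity).

(* ** Formulas, with de Bruijn indices *)

Inductive formula : Type :=
| FMem (i j : nat)
| FEq (i j : nat)
| FNot (p : formula)
| FAnd (p q : formula)
| FEx (p : formula).

Definition scons (T : Type) (x : T) (e : nat -> T) (n : nat) : T :=
  match n with
  | O => x
  | S m => e m
  end.

Fixpoint sat (A : structure) (p : formula) (e : nat -> A) : Prop :=
  match p with
  | FMem i j => e i ∈ e j
  | FEq i j => e i = e j
  | FNot q => ~ sat q e
  | FAnd q r => sat q e /\ sat r e
  | FEx q => exists x : A, sat q (scons x e)
  end.

(* Definability is with parameters, supplied by the environment [e]. *)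
Definition definable1 (A : structure) (P : A -> Prop) : Prop :=
  exists (p : formula) (e : nat -> A), forall x, P x <-> sat p (scons x e).

Definition definable2 (A : structure) (R : A -> A -> Prop) : Prop :=
  exists (p : formula) (e : nat -> A),
    forall x y, R x y <-> sat p (scons x (scons y e)).

(* ** Basic set theory in a structure *)

Definition subset (A : structure) (x y : A) : Prop :=
  forall z, z ∈ x -> z ∈ y.

Definition is_empty (A : structure) (x : A) : Prop := forall z, ~ z ∈ x.

Definition is_inter (A : structure) (c x y : A) : Prop :=
  forall z, z ∈ c <-> z ∈ x /\ z ∈ y.

Definition is_diff (A : structure) (c x y : A) : Prop :=
  forall z, z ∈ c <-> z ∈ x /\ ~ z ∈ y.

Definition is_power (A : structure) (p x : A) : Prop :=
  forall z, z ∈ p <-> subset z x.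

Definition is_upair (A : structure) (p x y : A) : Prop :=
  forall z, z ∈ p <-> z = x \/ z = y.

Definition is_succ (A : structure) (s x : A) : Prop :=
  forall z, z ∈ s <-> z ∈ x \/ z = x.

Definition is_opair (A : structure) (p x y : A) : Prop :=
  exists s t, is_upair s x x /\ is_upair t x y /\ is_upair p s t.

(* [app f x y] : the set [f] contains the ordered pair (x, y). *)
Definition app (A : structure) (f x y : A) : Prop :=
  exists p, is_opair p x y /\ p ∈ f.

Definition is_fun (A : structure) (f X : A) : Prop :=
  (forall p, p ∈ f -> exists x y, x ∈ X /\ is_opair p x y) /\
  (forall x, x ∈ X -> exists! y, app f x y).

Definition is_fun_to (A : structure) (f X Y : A) : Prop :=
  is_fun f X /\ forall x y, app f x y -> y ∈ Y.

Definition is_const (A : structure) (f X a : A) : Prop :=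
  is_fun f X /\ forall x y, app f x y -> y = a.

Definition is_id (A : structure) (f X : A) : Prop :=
  is_fun f X /\ forall x y, app f x y -> y = x.

Definition is_transitive (A : structure) (x : A) : Prop :=
  forall y, y ∈ x -> subset y x.

Definition is_ordinal (A : structure) (x : A) : Prop :=
  is_transitive x /\ forall y, y ∈ x -> is_transitive y.

Definition is_inductive (A : structure) (w : A) : Prop :=
  (exists z, is_empty z /\ z ∈ w) /\
  (forall x, x ∈ w -> exists s, is_succ s x /\ s ∈ w).

Definition is_omega (A : structure) (w : A) : Prop :=
  is_inductive w /\ forall v, is_inductive v -> subset w v.

(* ** ZFC *)

Record ZFC (A : structure) : Prop := {
  zfc_extensionality :
    forall x y : A, (forall z, z ∈ x <-> z ∈ y) -> x = y;
  zfc_foundation :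
    forall x : A, (exists z, z ∈ x) ->
    exists y, y ∈ x /\ forall z, z ∈ y -> ~ z ∈ x;
  zfc_pairing :
    forall x y : A, exists p, is_upair p x y;
  zfc_union :
    forall x : A, exists u, forall z, z ∈ u <-> exists y, y ∈ x /\ z ∈ y;
  zfc_power :
    forall x : A, exists p, is_power p x;
  zfc_infinity :
    exists w : A, is_inductive w;
  zfc_separation :
    forall (p : formula) (e : nat -> A) (x : A),
    exists y, forall z, z ∈ y <-> z ∈ x /\ sat p (scons z e);
  zfc_replacement :
    forall (p : formula) (e : nat -> A) (x : A),
    (forall u, u ∈ x -> exists! v, sat p (scons u (scons v e))) ->
    exists y, forall v, v ∈ y <-> exists u, u ∈ x /\ sat p (scons u (scons v e));
  zfc_choice :
    forall x : A,
    (forall y, y ∈ x -> exists z, z ∈ y) ->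
    (forall y y', y ∈ x -> y' ∈ x -> (exists z, z ∈ y /\ z ∈ y') -> y = y') ->
    exists c, forall y, y ∈ x -> exists! z, z ∈ y /\ z ∈ c
}.

(* ** Ultrafilters *)

Record ultrafilter (A : structure) (U X : A) : Prop := {
  uf_sub : forall Y, Y ∈ U -> subset Y X;
  uf_full : X ∈ U;
  uf_proper : forall Y, Y ∈ U -> ~ is_empty Y;
  uf_up : forall Y Z, Y ∈ U -> subset Y Z -> subset Z X -> Z ∈ U;
  uf_inter : forall Y Z C, Y ∈ U -> Z ∈ U -> is_inter C Y Z -> C ∈ U;
  uf_ultra : forall Y C, subset Y X -> is_diff C X Y -> Y ∈ U \/ C ∈ U
}.

Definition countably_complete (A : structure) (U X : A) : Prop :=
  forall w s C : A,
    is_omega w -> is_fun_to s w U ->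
    (forall x, x ∈ C <->
       x ∈ X /\ forall n Y, n ∈ w -> app s n Y -> x ∈ Y) ->
    C ∈ U.

Definition cc_ultrafilter (A : structure) (U X : A) : Prop :=
  ultrafilter U X /\ countably_complete U X.

(* [Un_on U a] : [U] belongs to Un and sp(U) = [a]. *)
Definition Un_on (A : structure) (U a : A) : Prop :=
  is_ordinal a /\ cc_ultrafilter U a /\
  forall b C, b ∈ a -> is_diff C a b -> C ∈ U.

Definition Un (A : structure) (U : A) : Prop := exists a, Un_on U a.

(* ** Classes and inner models *)

(* A class as a substructure; a formula evaluated in [sub M] is the formula
   relativized to [M]. *)
Definition sub (V : structure) (M : V -> Prop) : structure :=
  @Structure {x : V | M x} (fun a b => proj1_sig a ∈ proj1_sig b).

Definition univ (V : structure) : V -> Prop := fun _ => True.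

Definition in_univ (V : structure) (x : V) : sub (@univ V) :=
  exist (@univ V) x I.

Definition transitive_class (V : structure) (M : V -> Prop) : Prop :=
  forall x y : V, M x -> y ∈ x -> M y.

Definition inner_model (V : structure) (M : V -> Prop) : Prop :=
  definable1 M /\ transitive_class M /\
  (forall a : V, is_ordinal a -> M a) /\
  ZFC (sub M).

Definition elementary (A B : structure) (i : A -> B) : Prop :=
  forall (p : formula) (e : nat -> A), sat p e <-> sat p (fun n => i (e n)).

(* ** Ultrapowers *)

(* The set of x in X with P x exists and belongs to D. *)
Definition measure_one (A : structure) (D X : A) (P : A -> Prop) : Prop :=
  exists S, S ∈ D /\ forall x, x ∈ S <-> x ∈ X /\ P x.

(* [N] is the transitive collapse of the ultrapower of [M] by [D], an ultrafilter
   on [X], formed with the functions on [X] that belong to [M]; [rep f] is the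
   point of [N] represented by [f] (junk if [f] is not a function on [X]) and [j]
   is the ultrapower embedding.  As [rep] has to be definable over the universe,
   N, j and rep (on functions) are uniquely determined by M and D. *)
Record is_ultrapower (V : structure) (M N : V -> Prop) (D X : sub M)
    (rep j : sub M -> sub N) : Prop := {
  up_transitive : transitive_class N;
  up_definable :
    definable2 (fun x y : V =>
      exists f : sub M, is_fun f X /\ x = proj1_sig f /\ y = proj1_sig (rep f));
  up_eq : forall f g, is_fun f X -> is_fun g X ->
    (rep f = rep g <->
     measure_one D X (fun x => exists y, app f x y /\ app g x y));
  up_mem : forall f g, is_fun f X -> is_fun g X ->
    (rep f ∈ rep g <->
     measure_one D X (fun x => exists y z, app f x y /\ app g x z /\ y ∈ z));
  up_onto : forall y, exists f, is_fun f X /\ rep f = y;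
  up_embed : forall a f, is_const f X a -> j a = rep f
}.

(* The ultrapower of the universe by [U]: [M] is M_U, [j] is j_U, and [s] is the
   point represented by the identity. *)
Definition ultrapower_of (V : structure) (U : V) (M : V -> Prop)
    (j : sub (@univ V) -> sub M) (s : sub M) : Prop :=
  exists (X : V) (rep : sub (@univ V) -> sub M),
    ultrafilter U X /\
    is_ultrapower (in_univ U) (in_univ X) rep j /\
    forall f, is_id f (in_univ X) -> s = rep f.

(* "Ultrafilter" is evaluated inside [M], so that [D] only measures the subsets
   of [X] lying in [M]. *)
Definition internal_ultrapower_embedding (V : structure) (M N : V -> Prop)
    (i : sub M -> sub N) : Prop :=
  inner_model M /\ inner_model N /\ elementary i /\
  exists (D X : sub M) (rep : sub M -> sub N),
    ultrafilter D X /\ is_ultrapower D X rep i.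

Definition is_comparison (V : structure) (M0 M1 N : V -> Prop)
    (j0 : sub (@univ V) -> sub M0) (j1 : sub (@univ V) -> sub M1)
    (i0 : sub M0 -> sub N) (i1 : sub M1 -> sub N) : Prop :=
  internal_ultrapower_embedding i0 /\
  internal_ultrapower_embedding i1 /\
  forall x, i0 (j0 x) = i1 (j1 x).

Definition ultrapower_axiom (V : structure) : Prop :=
  forall U0 X0 U1 X1 : V,
    cc_ultrafilter U0 X0 -> cc_ultrafilter U1 X1 ->
    exists (M0 M1 : V -> Prop)
      (j0 : sub (@univ V) -> sub M0) (s0 : sub M0)
      (j1 : sub (@univ V) -> sub M1) (s1 : sub M1),
      ultrapower_of U0 j0 s0 /\ ultrapower_of U1 j1 s1 /\
      exists (N : V -> Prop) (i0 : sub M0 -> sub N) (i1 : sub M1 -> sub N),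
        is_comparison j0 j1 i0 i1.

Definition seed_lt (V : structure) (U0 U1 : V) : Prop :=
  exists (M0 M1 : V -> Prop)
    (j0 : sub (@univ V) -> sub M0) (s0 : sub M0)
    (j1 : sub (@univ V) -> sub M1) (s1 : sub M1),
    ultrapower_of U0 j0 s0 /\ ultrapower_of U1 j1 s1 /\
    exists (N : V -> Prop) (i0 : sub M0 -> sub N) (i1 : sub M1 -> sub N),
      is_comparison j0 j1 i0 i1 /\ i0 s0 ∈ i1 s1.

(* ** The Lipschitz order *)

(* [f] is a function from the power set of [d] to itself. *)
Definition strongly_lipschitz (A : structure) (d f : A) : Prop :=
  forall X Xa Y Ya a : A,
    subset X d -> a ∈ d -> is_inter Xa X a ->
    app f X Y -> app f Xa Ya -> (a ∈ Y <-> a ∈ Ya).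

Definition lipschitz_sets (A : structure) (d S T : A) : Prop :=
  exists P f : A,
    is_power P d /\ is_fun_to f P P /\ strongly_lipschitz d f /\
    forall X, X ∈ S <-> exists Y, app f X Y /\ Y ∈ T.

Definition is_max (A : structure) (d a b : A) : Prop :=
  (d = a /\ subset b a) \/ (d = b /\ subset a b).

(* [U'] is the set of subsets X of [d] such that the intersection of X with [a]
   is in [U]. *)
Definition is_extension (A : structure) (U' d U a : A) : Prop :=
  forall X, X ∈ U' <-> subset X d /\ exists C, is_inter C X a /\ C ∈ U.

Definition lipschitz_lt (A : structure) (U W : A) : Prop :=
  exists a b d U' W' : A,
    Un_on U a /\ Un_on W b /\ is_max d a b /\
    is_extension U' d U a /\ is_extension W' d W b /\
    lipschitz_sets d U' W'.

Definition ultrafilter_determinacy (A : structure) : Prop :=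
  forall U W : A, Un U -> Un W -> U <> W ->
    lipschitz_lt U W \/ lipschitz_lt W U.

(* Main.v *)
(* Let (i0, i1) be a comparison of (j_U, j_W) with i0(s_U) < i1(s_W).  Then
   X ∈ U iff i0(s_U) ∈ i1(j_W(X) ∩ s_W), and since i1 is an internal ultrapower
   of M_W, the set of Z ⊆ s_W in M_W with i0(s_U) ∈ i1(Z) belongs to M_W, say it
   is represented by x |-> u_x.  As j_W(X) ∩ s_W is represented by x |-> X ∩ x,
   X |-> {x : X ∩ x ∈ u_x} is a strongly Lipschitz reduction of U to W.  So the
   seed order, which is total by the Ultrapower Axiom, is contained in the
   Lipschitz order, and they coincide because the latter is asymmetric: the
   strongly Lipschitz relation is transitive, and a strongly Lipschitz f sends
   some X, built by recursion, to its complement, so that it does not reduce an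
   ultrafilter to itself. *)

From Stdlib Require Import Classical.
Require Import Defs.

Set Implicit Arguments.
Unset Strict Implicit.
Unset Printing Implicit Defensive.

(** * Derived connectives and the meaning of formulas *)

Definition FOr (p q : formula) : formula := FNot (FAnd (FNot p) (FNot q)).
Definition FImp (p q : formula) : formula := FNot (FAnd p (FNot q)).
Definition FIff (p q : formula) : formula := FAnd (FImp p q) (FImp q p).
Definition FAll (p : formula) : formula := FNot (FEx (FNot p)).

Lemma sat_ex_iff (A : structure) p (e : nat -> A) (P : A -> Prop) :
  (forall x, sat p (scons x e) <-> P x) -> sat (FEx p) e <-> exists x, P x.
Proof. simpl; firstorder. Qed.

Lemma sat_all_iff (A : structure) p (e : nat -> A) (P : A -> Prop) :
  (forall x, sat p (scons x e) <-> P x) -> sat (FAll p) e <-> forall x, P x.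
Proof.
intro Hp; simpl; split.
- intros H x; apply NNPP; intro Hx; apply H; exists x; now rewrite Hp.
- intros H [x Hx]; now apply Hx, Hp.
Qed.

Lemma sat_not_iff (A : structure) p (e : nat -> A) (P : Prop) :
  (sat p e <-> P) -> sat (FNot p) e <-> ~ P.
Proof. simpl; tauto. Qed.

Lemma sat_and_iff (A : structure) p q (e : nat -> A) (P Q : Prop) :
  (sat p e <-> P) -> (sat q e <-> Q) -> sat (FAnd p q) e <-> P /\ Q.
Proof. simpl; tauto. Qed.

Lemma sat_or_iff (A : structure) p q (e : nat -> A) (P Q : Prop) :
  (sat p e <-> P) -> (sat q e <-> Q) -> sat (FOr p q) e <-> P \/ Q.
Proof. simpl; tauto. Qed.

Lemma sat_imp_iff (A : structure) p q (e : nat -> A) (P Q : Prop) :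
  (sat p e <-> P) -> (sat q e <-> Q) -> sat (FImp p q) e <-> (P -> Q).
Proof. simpl; tauto. Qed.

Lemma sat_iff_iff (A : structure) p q (e : nat -> A) (P Q : Prop) :
  (sat p e <-> P) -> (sat q e <-> Q) -> sat (FIff p q) e <-> (P <-> Q).
Proof. simpl; tauto. Qed.

(** A hook, rebound once the codes of application, ordered pairs and intersections have been given
    their meaning. *)
Ltac sat_atom := fail.

(** The formula dictates the steps, and the property on the right is matched up to conversion. At
    the atoms the lookups in [scons] environments compute, so [iff_refl] closes them. *)
Ltac sat_step :=
  lazymatch goal with
  | |- sat (FMem _ _) _ <-> _ => apply iff_refl
  | |- sat (FEq _ _) _ <-> _ => apply iff_refl
  | |- sat (FAll _) _ <-> _ => apply sat_all_iff; intro
  | |- sat (FEx _) _ <-> _ => apply sat_ex_iff; intro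
  | |- sat (FAnd _ _) _ <-> _ => apply sat_and_iff
  | |- sat (FNot _) _ <-> _ => apply sat_not_iff
  | |- sat (FIff _ _) _ <-> _ => apply sat_iff_iff
  | |- sat (FImp _ _) _ <-> _ => apply sat_imp_iff
  | |- sat (FOr _ _) _ <-> _ => apply sat_or_iff
  | |- _ => sat_atom
  end.
Ltac sat_tac := repeat sat_step.

Definition FUpair (p x y : nat) : formula :=
  FAll (FIff (FMem 0 (S p)) (FOr (FEq 0 (S x)) (FEq 0 (S y)))).
Definition FOpair (p x y : nat) : formula :=
  FEx (FEx (FAnd (FUpair 1 (2 + x) (2 + x))
    (FAnd (FUpair 0 (2 + x) (2 + y)) (FUpair (2 + p) 1 0)))).
Definition FApp (f x y : nat) : formula :=
  FEx (FAnd (FOpair 0 (S x) (S y)) (FMem 0 (S f))).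
Definition FUnique (f x : nat) : formula :=
  FEx (FAnd (FApp (S f) (S x) 0)
    (FAll (FImp (FApp (2 + f) (2 + x) 0) (FEq 1 0)))).
Definition FFun (f X : nat) : formula :=
  FAnd
    (FAll (FImp (FMem 0 (S f))
      (FEx (FEx (FAnd (FMem 1 (3 + X)) (FOpair 2 1 0))))))
    (FAll (FImp (FMem 0 (S X)) (FUnique (S f) 0))).
Definition FInter (c x y : nat) : formula :=
  FAll (FIff (FMem 0 (S c)) (FAnd (FMem 0 (S x)) (FMem 0 (S y)))).
Definition FTransitive (x : nat) : formula :=
  FAll (FImp (FMem 0 (S x)) (FAll (FImp (FMem 0 1) (FMem 0 (2 + x))))).
Definition FOrdinal (x : nat) : formula :=
  FAnd (FTransitive x) (FAll (FImp (FMem 0 (S x)) (FTransitive 0))).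

Lemma sat_upair (A : structure) p x y (e : nat -> A) :
  sat (FUpair p x y) e <-> is_upair (e p) (e x) (e y).
Proof. unfold FUpair, is_upair; sat_tac. Qed.

Lemma sat_opair (A : structure) p x y (e : nat -> A) :
  sat (FOpair p x y) e <-> is_opair (e p) (e x) (e y).
Proof.
unfold FOpair, is_opair; sat_tac; exact (sat_upair _ _ _ _).
Qed.

Lemma sat_app (A : structure) f x y (e : nat -> A) :
  sat (FApp f x y) e <-> app (e f) (e x) (e y).
Proof. unfold FApp, app; sat_tac; exact (sat_opair _ _ _ _). Qed.

Lemma sat_fun (A : structure) f X (e : nat -> A) :
  sat (FFun f X) e <-> is_fun (e f) (e X).
Proof.
unfold FFun, is_fun, FUnique, unique; sat_tac;
  first [exact (sat_opair _ _ _ _) | exact (sat_app _ _ _ _)].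
Qed.

Lemma sat_inter (A : structure) c x y (e : nat -> A) :
  sat (FInter c x y) e <-> is_inter (e c) (e x) (e y).
Proof. unfold FInter, is_inter; sat_tac. Qed.

Lemma sat_transitive (A : structure) x (e : nat -> A) :
  sat (FTransitive x) e <-> is_transitive (e x).
Proof. unfold FTransitive, is_transitive, subset; sat_tac. Qed.

Lemma sat_ordinal (A : structure) x (e : nat -> A) :
  sat (FOrdinal x) e <-> is_ordinal (e x).
Proof. unfold FOrdinal, is_ordinal; sat_tac; exact (sat_transitive _ _). Qed.

Ltac sat_atom ::=
  first
  [ exact (sat_app _ _ _ _) | exact (sat_opair _ _ _ _)
  | exact (sat_inter _ _ _ _) ].

Lemma app_elementary (A B : structure) (i : A -> B) (f x y : A) :
  elementary i -> app f x y <-> app (i f) (i x) (i y).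
Proof.
intro Hi; pose (e := scons f (scons x (fun _ => y))).
exact (iff_trans (iff_sym (sat_app 0 1 2 e))
  (iff_trans (Hi _ e) (sat_app 0 1 2 (fun n => i (e n))))).
Qed.

Lemma fun_elementary (A B : structure) (i : A -> B) (f X : A) :
  elementary i -> is_fun f X <-> is_fun (i f) (i X).
Proof.
intro Hi; pose (e := scons f (fun _ => X)).
exact (iff_trans (iff_sym (sat_fun 0 1 e))
  (iff_trans (Hi _ e) (sat_fun 0 1 (fun n => i (e n))))).
Qed.

Lemma inter_elementary (A B : structure) (i : A -> B) (c x y : A) :
  elementary i -> is_inter c x y <-> is_inter (i c) (i x) (i y).
Proof.
intro Hi; pose (e := scons c (scons x (fun _ => y))).
exact (iff_trans (iff_sym (sat_inter 0 1 2 e))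
  (iff_trans (Hi _ e) (sat_inter 0 1 2 (fun n => i (e n))))).
Qed.

Lemma ordinal_elementary (A B : structure) (i : A -> B) (x : A) :
  elementary i -> is_ordinal x <-> is_ordinal (i x).
Proof.
intro Hi; pose (e := fun _ : nat => x).
exact (iff_trans (iff_sym (sat_ordinal 0 e))
  (iff_trans (Hi _ e) (sat_ordinal 0 (fun n => i (e n))))).
Qed.

Lemma mem_elementary (A B : structure) (i : A -> B) (x y : A) :
  elementary i -> x ∈ y <-> i x ∈ i y.
Proof. intro Hi; exact (Hi (FMem 0 1) (scons x (fun _ => y))). Qed.

(** * Sets, ordered pairs and functions from the axioms *)

Lemma separation (A : structure) (hA : ZFC A) p (e : nat -> A) (P : A -> Prop)
    (x : A) :
  (forall z, sat p (scons z e) <-> P z) ->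
  exists y, forall z, z ∈ y <-> z ∈ x /\ P z.
Proof.
intro Hp; destruct (zfc_separation hA p e x) as [y Hy].
exists y; intro z; rewrite Hy, Hp; reflexivity.
Qed.

Lemma inter_exists (A : structure) (hA : ZFC A) (x y : A) :
  exists c, is_inter c x y.
Proof.
apply (@separation A hA (FMem 0 1) (fun _ => y)); intro; reflexivity.
Qed.

Lemma diff_exists (A : structure) (hA : ZFC A) (x y : A) :
  exists c, is_diff c x y.
Proof.
apply (@separation A hA (FNot (FMem 0 1)) (fun _ => y)); intro; reflexivity.
Qed.

Lemma inter_unique (A : structure) (hA : ZFC A) (c c' x y : A) :
  is_inter c x y -> is_inter c' x y -> c = c'.
Proof.
intros H H'; apply (zfc_extensionality hA); intro z.
rewrite (H z), (H' z); reflexivity.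
Qed.

Lemma subset_antisym (A : structure) (hA : ZFC A) (x y : A) :
  subset x y -> subset y x -> x = y.
Proof.
intros H H'; apply (zfc_extensionality hA); intro z; split; auto.
Qed.

Lemma upair_inj (A : structure) (p x y x' y' : A) :
  is_upair p x y -> is_upair p x' y' ->
  x = x' /\ y = y' \/ x = y' /\ y = x'.
Proof.
intros H H'.
assert (x = x' \/ x = y') by (apply H', H; now left).
assert (y = x' \/ y = y') by (apply H', H; now right).
assert (x' = x \/ x' = y) by (apply H, H'; now left).
assert (y' = x \/ y' = y) by (apply H, H'; now right).
intuition congruence.
Qed.

Lemma upair_unique (A : structure) (hA : ZFC A) (p p' x y : A) :
  is_upair p x y -> is_upair p' x y -> p = p'.
Proof.
intros H H'; apply (zfc_extensionality hA); intro z.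
rewrite (H z), (H' z); reflexivity.
Qed.

Lemma opair_exists (A : structure) (hA : ZFC A) (x y : A) :
  exists p, is_opair p x y.
Proof.
destruct (zfc_pairing hA x x) as [s Hs].
destruct (zfc_pairing hA x y) as [t Ht].
destruct (zfc_pairing hA s t) as [p Hp].
now exists p, s, t.
Qed.

Lemma opair_unique (A : structure) (hA : ZFC A) (p p' x y : A) :
  is_opair p x y -> is_opair p' x y -> p = p'.
Proof.
intros [s [t [Hs [Ht Hp]]]] [s' [t' [Hs' [Ht' Hp']]]].
rewrite (upair_unique hA Hs' Hs), (upair_unique hA Ht' Ht) in Hp'.
exact (upair_unique hA Hp Hp').
Qed.

Lemma opair_inj (A : structure) (p x y x' y' : A) :
  is_opair p x y -> is_opair p x' y' -> x = x' /\ y = y'.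
Proof.
intros [s [t [Hs [Ht Hp]]]] [s' [t' [Hs' [Ht' Hp']]]].
destruct (upair_inj Hp Hp') as [[<- <-]|[<- <-]].
- assert (x = x') by (destruct (upair_inj Hs Hs'); tauto).
  destruct (upair_inj Ht Ht'); intuition congruence.
- destruct (upair_inj Hs Ht'), (upair_inj Ht Hs'); intuition congruence.
Qed.

Lemma app_functional (A : structure) (f X x y y' : A) :
  is_fun f X -> app f x y -> app f x y' -> y = y'.
Proof.
intros [Hdom Huniq] Hy Hy'.
pose proof Hy as [p [Hp Hpf]].
destruct (Hdom p Hpf) as [x0 [y0 [Hx0 Hp0]]].
destruct (opair_inj Hp Hp0) as [<- <-].
destruct (Huniq x Hx0) as [z [_ Hz]].
rewrite <- (Hz y), <- (Hz y'); auto.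
Qed.

Lemma app_dom (A : structure) (f X x y : A) :
  is_fun f X -> app f x y -> x ∈ X.
Proof.
intros [Hdom _] [p [Hp Hpf]].
destruct (Hdom p Hpf) as [x0 [y0 [Hx0 Hp0]]].
now destruct (opair_inj Hp Hp0) as [-> _].
Qed.

Lemma app_total (A : structure) (f X x : A) :
  is_fun f X -> x ∈ X -> exists y, app f x y.
Proof.
intros [_ Huniq] Hx; destruct (Huniq x Hx) as [y [Hy _]]; now exists y.
Qed.

(* The formula is evaluated with a dummy entry [v] after its two arguments: this
   is where Replacement puts the ordered pair, so that no renaming of [p] is
   needed. *)
Lemma graph_exists (A : structure) (hA : ZFC A) p (e : nat -> A)
    (R : A -> A -> Prop) (X : A) :
  (forall x y v, sat p (scons y (scons x (scons v e))) <-> R x y) ->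
  (forall x, x ∈ X -> exists! y, R x y) ->
  exists f, is_fun f X /\ forall x y, app f x y <-> x ∈ X /\ R x y.
Proof.
intros Hp HR.
pose (q := FEx (FAnd (FOpair 2 1 0) p)).
assert (Hq : forall u v, sat q (scons u (scons v e)) <->
    exists y, is_opair v u y /\ R u y).
{ intros u v; unfold q; sat_tac; apply Hp. }
destruct (zfc_replacement hA (p := q) (e := e) (x := X)) as [f Hf].
{ intros u Hu; destruct (HR u Hu) as [y [Hy Hy']].
  destruct (opair_exists hA u y) as [v Hv].
  exists v; split.
  - apply Hq; now exists y.
  - intros v' Hv'; apply Hq in Hv'; destruct Hv' as [y' [Hv' HRy']].
    rewrite <- (Hy' _ HRy') in Hv'; exact (opair_unique hA Hv Hv'). }
assert (Happ : forall x y, app f x y <-> x ∈ X /\ R x y).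
{ intros x y; split.
  - intros [v [Hv Hvf]]; apply Hf in Hvf.
    destruct Hvf as [u [Hu Huv]]; apply Hq in Huv.
    destruct Huv as [y' [Hv' HRy']].
    destruct (opair_inj Hv Hv') as [-> ->]; auto.
  - intros [Hx Hxy]; destruct (opair_exists hA x y) as [v Hv].
    exists v; split; [exact Hv|]; apply Hf; exists x; split; [exact Hx|].
    apply Hq; now exists y. }
exists f; split; [split|exact Happ].
- intros v Hv; apply Hf in Hv; destruct Hv as [u [Hu Huv]]; apply Hq in Huv.
  destruct Huv as [y [Hv _]]; now exists u, y.
- intros x Hx; destruct (HR x Hx) as [y [Hy Hy']].
  exists y; split.
  + now apply Happ.
  + intros y' H; apply Hy', Happ, H.
Qed.

Lemma const_exists (A : structure) (hA : ZFC A) (X a : A) :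
  exists f, is_const f X a /\ forall x, x ∈ X -> app f x a.
Proof.
destruct (@graph_exists A hA (FEq 0 3) (fun _ => a) (fun _ y => y = a) X)
  as [f [Hf Happ]].
- intros; reflexivity.
- intros x _; exists a; split; auto.
- exists f; split; [split|].
  + exact Hf.
  + intros x y H; now apply Happ in H.
  + intros x Hx; now apply Happ.
Qed.

Lemma id_exists (A : structure) (hA : ZFC A) (X : A) :
  exists f, is_id f X /\ forall x, x ∈ X -> app f x x.
Proof.
destruct (@graph_exists A hA (FEq 0 1) (fun _ => X) (fun x y => y = x) X)
  as [f [Hf Happ]].
- intros; reflexivity.
- intros x _; exists x; split; auto.
- exists f; split; [split|].
  + exact Hf.
  + intros x y H; now apply Happ in H.
  + intros x Hx; now apply Happ.
Qed.

(** * Ordinals: induction, trichotomy, maxima *)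

Lemma ordinal_mem (A : structure) (x y : A) :
  is_ordinal x -> y ∈ x -> is_ordinal y.
Proof.
intros [Ht Hm] Hy; split; [now apply Hm|].
intros z Hz; apply Hm, (Ht y Hy z Hz).
Qed.

(** The property comes with a formula so that Separation can collect its counterexamples; Foundation
    then yields a minimal one. *)
Lemma ordinal_induction (A : structure) (hA : ZFC A) p (e : nat -> A)
    (P : A -> Prop) :
  (forall z, sat p (scons z e) <-> P z) ->
  (forall x, is_ordinal x -> (forall y, y ∈ x -> P y) -> P x) ->
  forall x, is_ordinal x -> P x.
Proof.
intros Hp Hind x Hx.
(* Using the hypothesis at [x] first places the counterexample inside [x], which bounds the set to
   be separated. *)
apply (Hind x Hx); intros y Hy; apply NNPP; intro HPy.
destruct (@separation A hA (FNot p) e (fun z => ~ P z) x) as [b Hb].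
{ intro z; apply sat_not_iff, Hp. }
destruct (zfc_foundation hA (x := b)) as [m [Hm Hmin]].
{ exists y; now apply Hb. }
apply Hb in Hm; destruct Hm as [Hmx HPm]; apply HPm, Hind.
- exact (ordinal_mem Hx Hmx).
- intros z Hz; apply NNPP; intro HPz; apply (Hmin z Hz), Hb.
  split; [exact (proj1 Hx m Hmx z Hz)|exact HPz].
Qed.

Lemma ordinal_trichotomy (A : structure) (hA : ZFC A) (x y : A) :
  is_ordinal x -> is_ordinal y -> x ∈ y \/ x = y \/ y ∈ x.
Proof.
(* The outer formula has no parameters; [c] merely fills its environment. *)
intros Hx; pose proof x as c; revert y; pattern x; revert x Hx.
apply (@ordinal_induction A hA
  (FAll (FImp (FOrdinal 0) (FOr (FMem 1 0) (FOr (FEq 1 0) (FMem 0 1)))))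
  (fun _ => c)).
1: { intro z; sat_tac; exact (sat_ordinal _ _). }
intros x Hx IHx y Hy; pattern y; revert y Hy.
apply (@ordinal_induction A hA (FOr (FMem 1 0) (FOr (FEq 1 0) (FMem 0 1)))
  (fun _ => x)).
1: { intro z; sat_tac. }
intros y Hy IHy; apply NNPP; intro H.
apply H; right; left; apply (subset_antisym hA).
- intros z Hz; destruct (IHx z Hz y Hy) as [|[->|Hyz]]; [assumption|tauto|].
  destruct H; right; right; exact (proj1 Hx z Hz y Hyz).
- intros z Hz; destruct (IHy z Hz) as [Hxz|[->|]]; [|tauto|assumption].
  destruct H; left; exact (proj1 Hy z Hz x Hxz).
Qed.

Lemma ordinal_max (A : structure) (hA : ZFC A) (a b : A) :
  is_ordinal a -> is_ordinal b -> exists d, is_max d a b /\ is_ordinal d.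
Proof.
intros Ha Hb; destruct (ordinal_trichotomy hA Ha Hb) as [H|[->|H]].
- exists b; split; [right; split; [reflexivity|]|exact Hb].
  exact (proj1 Hb a H).
- exists b; split; [left; split; [reflexivity|]|exact Hb].
  intros z Hz; exact Hz.
- exists a; split; [left; split; [reflexivity|]|exact Ha].
  exact (proj1 Ha b H).
Qed.

(** * Strongly Lipschitz functions: composition and sets sent to their complement *)

(** The reductions compose: f(X) and f(X ∩ a) agree below [a], and [g] decides [a] from that part
    alone. *)
Lemma lipschitz_sets_trans (A : structure) (hA : ZFC A) (d S T R : A) :
  is_ordinal d -> lipschitz_sets d S T -> lipschitz_sets d T R ->
  lipschitz_sets d S R.
Proof.
intros Hd [P [f [HP [[Hf HfP] [Lf HfS]]]]] [P' [g [HP' [[Hg HgP] [Lg HgT]]]]].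
assert (P' = P) as ->.
{ apply (zfc_extensionality hA); intro z; now rewrite (HP z), (HP' z). }
destruct (@graph_exists A hA (FEx (FAnd (FApp 4 2 0) (FApp 5 0 1)))
  (scons f (fun _ => g)) (fun X Z => exists Y, app f X Y /\ app g Y Z) P)
  as [h [Hh Happ]].
{ intros x y v; sat_tac. }
{ intros X HX.
  destruct (app_total Hf HX) as [Y HY].
  destruct (app_total Hg (HfP _ _ HY)) as [Z HZ].
  exists Z; split; [now exists Y|].
  intros Z' [Y' [HY' HZ']].
  rewrite (app_functional Hf HY' HY) in HZ'.
  exact (app_functional Hg HZ HZ'). }
exists P, h; split; [exact HP|]; split; [split; [exact Hh|]|]; [|split].
- intros X Z HXZ; apply Happ in HXZ; destruct HXZ as [_ [Y [_ HY]]].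
  exact (HgP _ _ HY).
- intros X Xa Z Za a HX Ha HXa HZ HZa.
  apply Happ in HZ; destruct HZ as [HXP [Y [HY HZ]]].
  apply Happ in HZa; destruct HZa as [HXaP [Ya [HYa HZa]]].
  destruct (inter_exists hA Y a) as [C HC].
  assert (HC' : is_inter C Ya a).
  { intro b; rewrite (HC b).
    enough (b ∈ a -> b ∈ Y <-> b ∈ Ya) by tauto.
    intro Hb.
    assert (Hbd : b ∈ d) by exact (proj1 Hd a Ha b Hb).
    destruct (inter_exists hA X b) as [Xb HXb].
    (* For b ∈ a, transitivity of [a] gives X ∩ b = (X ∩ a) ∩ b, so [f] decides [b] alike on X and
       on X ∩ a. *)
    assert (HXb' : is_inter Xb Xa b).
    { intro c; rewrite (HXb c), (HXa c).
      enough (c ∈ b -> c ∈ a) by tauto.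
      exact (proj1 (ordinal_mem Hd Ha) b Hb c). }
    assert (HXbP : Xb ∈ P).
    { apply HP; intros c Hc; apply HX; now apply HXb in Hc. }
    destruct (app_total Hf HXbP) as [Yb HYb].
    rewrite (Lf X Xb Y Yb b HX Hbd HXb HY HYb).
    symmetry; refine (Lf Xa Xb Ya Yb b _ Hbd HXb' HYa HYb).
    now apply HP. }
  assert (HCP : C ∈ P).
  { apply HP; intros b Hb; apply HC in Hb.
    exact (proj1 Hd a Ha b (proj2 Hb)). }
  destruct (app_total Hg HCP) as [D HD].
  rewrite (Lg Y C Z D a); auto.
  + rewrite (Lg Ya C Za D a); auto; [reflexivity|].
    apply HP; exact (HfP _ _ HYa).
  + apply HP; exact (HfP _ _ HY).
- intro X; rewrite HfS; split.
  + intros [Y [HY HYT]]; apply HgT in HYT; destruct HYT as [Z [HZ HZR]].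
    exists Z; split; [|exact HZR]; apply Happ; split; [|now exists Y].
    exact (app_dom Hf HY).
  + intros [Z [HZ HZR]]; apply Happ in HZ; destruct HZ as [_ [Y [HY HZ]]].
    exists Y; split; [exact HY|]; apply HgT; now exists Z.
Qed.

(* [Y] solves the equation "Y is the complement of f(Y)" as far as ordinals
   below [a] are concerned. *)
Definition anti_fixed_below (A : structure) (f a Y : A) : Prop :=
  subset Y a /\ forall c, c ∈ a -> forall C D,
    is_inter C Y c -> app f C D -> (c ∈ Y <-> ~ c ∈ D).

Definition FAntiFixedBelow (f a Y : nat) : formula :=
  FAnd (FAll (FImp (FMem 0 (S Y)) (FMem 0 (S a))))
    (FAll (FImp (FMem 0 (S a)) (FAll (FAll
      (FImp (FInter 1 (3 + Y) 2) (FImp (FApp (3 + f) 1 0)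
        (FIff (FMem 2 (3 + Y)) (FNot (FMem 2 0))))))))).

Lemma sat_anti_fixed_below (A : structure) f a Y (e : nat -> A) :
  sat (FAntiFixedBelow f a Y) e <-> anti_fixed_below (e f) (e a) (e Y).
Proof. unfold FAntiFixedBelow, anti_fixed_below, subset; sat_tac. Qed.

(** The equation is a recursion: whether c ∈ Y is forced by Y ∩ c, so two solutions agree by
    induction on [c]. *)
Lemma anti_fixed_below_unique (A : structure) (hA : ZFC A) (d P f a Y Y' : A) :
  is_ordinal d -> is_power P d -> is_fun f P -> a ∈ d ->
  anti_fixed_below f a Y -> anti_fixed_below f a Y' -> Y = Y'.
Proof.
intros Hd HP Hf Ha [HYa HY] [HY'a HY'].
assert (Hord := ordinal_mem Hd Ha).
assert (Heq : forall c, is_ordinal c -> c ∈ a -> (c ∈ Y <-> c ∈ Y')).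
{ apply (@ordinal_induction A hA
    (FImp (FMem 0 1) (FIff (FMem 0 2) (FMem 0 3)))
    (scons a (scons Y (fun _ => Y'))) (fun c => c ∈ a -> c ∈ Y <-> c ∈ Y')).
  1: { intro z; sat_tac. }
  intros c Hc IH Hca.
  destruct (inter_exists hA Y c) as [C HC].
  assert (HC' : is_inter C Y' c).
  { intro b; rewrite (HC b).
    enough (b ∈ c -> b ∈ Y <-> b ∈ Y') by tauto.
    intro Hb; apply (IH b Hb); exact (proj1 Hord c Hca b Hb). }
  assert (HCP : C ∈ P).
  { apply HP; intros b Hb; apply HC in Hb.
    exact (proj1 Hd a Ha b (HYa b (proj1 Hb))). }
  destruct (app_total Hf HCP) as [D HD].
  rewrite (HY c Hca C D HC HD), (HY' c Hca C D HC' HD); reflexivity. }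
apply (zfc_extensionality hA); intro c; split; intro Hc.
- apply Heq; auto; exact (ordinal_mem Hord (HYa c Hc)).
- apply Heq; auto; exact (ordinal_mem Hord (HY'a c Hc)).
Qed.

Lemma lipschitz_anti_fixed_point (A : structure) (hA : ZFC A) (d P f : A) :
  is_ordinal d -> is_power P d -> is_fun_to f P P -> strongly_lipschitz d f ->
  exists X Y, app f X Y /\ is_diff Y d X.
Proof.
intros Hd HP [Hf HfP] Lf.
(* X collects the ordinals [a] that the recursion admits: those outside f(Y) for a solution [Y]
   below [a]. *)
destruct (@separation A hA
  (FEx (FEx (FAnd (FAntiFixedBelow 3 2 1)
    (FAnd (FApp 3 1 0) (FNot (FMem 2 0))))))
  (fun _ => f)
  (fun a => exists Y D, anti_fixed_below f a Y /\ app f Y D /\ ~ a ∈ D) d)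
  as [X HX].
{ intro z; sat_tac; exact (sat_anti_fixed_below _ _ _ _). }
assert (HXd : subset X d) by (intros a Ha; now apply HX in Ha).
(* The initial segments of X are themselves the solutions, which settles existence as well;
   uniqueness identifies any other solution with them. *)
assert (Hinit : forall a, is_ordinal a -> a ∈ d ->
    forall C, is_inter C X a -> anti_fixed_below f a C).
{ apply (@ordinal_induction A hA
    (FImp (FMem 0 1) (FAll (FImp (FInter 0 3 1) (FAntiFixedBelow 4 1 0))))
    (scons d (scons X (fun _ => f)))
    (fun a => a ∈ d -> forall C, is_inter C X a -> anti_fixed_below f a C)).
  1: { intro z; sat_tac; exact (sat_anti_fixed_below _ _ _ _). }
  intros a Ha IH Had C HC; split.
  { intros c Hc; now apply HC in Hc. }
  intros c Hca B D HB HBD.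
  assert (Hcd : c ∈ d) by exact (proj1 Hd a Had c Hca).
  assert (HB' : is_inter B X c).
  { intro b; rewrite (HB b), (HC b).
    enough (b ∈ c -> b ∈ a) by tauto.
    exact (proj1 Ha c Hca b). }
  pose proof (IH c Hca Hcd B HB') as HBc.
  rewrite (HC c), (HX c); split.
  - intros [[_ [Y [E [HY [HYE HcE]]]]] _].
    rewrite (anti_fixed_below_unique hA Hd HP Hf Hcd HY HBc) in HYE.
    now rewrite (app_functional Hf HBD HYE).
  - intro HcD; repeat split; auto; now exists B, D. }
assert (HXP : X ∈ P) by now apply HP.
destruct (app_total Hf HXP) as [Y HY].
exists X, Y; split; [exact HY|].
assert (HYd : subset Y d) by (apply HP; exact (HfP _ _ HY)).
intro a; split.
- intro HaY; pose proof (HYd a HaY) as Had; split; [exact Had|].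
  intro HaX; apply HX in HaX; destruct HaX as [_ [C [D [HC [HCD HaD]]]]].
  destruct (inter_exists hA X a) as [C' HC'].
  rewrite (anti_fixed_below_unique hA Hd HP Hf Had HC
    (Hinit a (ordinal_mem Hd Had) Had C' HC')) in HCD.
  now apply HaD, (Lf X C' Y D a HXd Had HC' HY HCD).
- intros [Had HaX]; apply NNPP; intro HaY; apply HaX, HX.
  split; [exact Had|].
  destruct (inter_exists hA X a) as [C HC].
  assert (HCP : C ∈ P).
  { apply HP; intros b Hb; apply HXd; now apply HC in Hb. }
  destruct (app_total Hf HCP) as [D HD].
  exists C, D; split; [exact (Hinit a (ordinal_mem Hd Had) Had C HC)|].
  split; [exact HD|]; intro HaD; apply HaY.
  now apply (Lf X C Y D a HXd Had HC HY HD).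
Qed.

(** * Asymmetry of the Lipschitz order *)

(** Membership in the extension of [U], freed from the bound [d], so that ultrafilters on different
    ordinals can be compared directly. *)
Definition trace_in (A : structure) (U a X : A) : Prop :=
  exists C, is_inter C X a /\ C ∈ U.

Lemma ultrafilter_space_unique (A : structure) (hA : ZFC A) (U a a' : A) :
  ultrafilter U a -> ultrafilter U a' -> a = a'.
Proof.
intros H H'; apply (subset_antisym hA).
- apply (uf_sub H'), (uf_full H).
- apply (uf_sub H), (uf_full H').
Qed.

(** A self-reduction [f] measures X and f(X) alike. If f(X) is the complement of X, their traces on
    [a] are complementary, and [U] contains exactly one of them. *)
Lemma lipschitz_sets_extension_irrefl (A : structure) (hA : ZFC A)
    (d U' U a : A) :
  is_ordinal d -> ultrafilter U a -> subset a d -> is_extension U' d U a ->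
  ~ lipschitz_sets d U' U'.
Proof.
intros Hd HU Had HU' [P [f [HP [Hf [Lf HfU]]]]].
destruct (lipschitz_anti_fixed_point hA Hd HP Hf Lf) as [X [Y [HXY HY]]].
assert (HXd : subset X d) by (apply HP; exact (app_dom (proj1 Hf) HXY)).
assert (HYd : subset Y d) by (intros z Hz; now apply HY in Hz).
assert (Heq : X ∈ U' <-> Y ∈ U').
{ rewrite HfU; split.
  - intros [Y' [HXY' HY'U]].
    now rewrite (app_functional (proj1 Hf) HXY HXY').
  - intro HYU; now exists Y. }
destruct (inter_exists hA X a) as [C HC].
destruct (diff_exists hA a C) as [D HD].
assert (HD' : is_inter D Y a).
{ intro z; rewrite (HD z), (HC z), (HY z).
  enough (z ∈ a -> z ∈ d) by tauto; apply Had. }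
assert (HXC : X ∈ U' <-> C ∈ U).
{ rewrite (HU' X); split.
  - intros [_ [C' [HC' HC'U]]]; now rewrite (inter_unique hA HC HC').
  - intro; split; [assumption|]; now exists C. }
assert (HYD : Y ∈ U' <-> D ∈ U).
{ rewrite (HU' Y); split.
  - intros [_ [D' [HD'' HDU]]]; now rewrite (inter_unique hA HD' HD'').
  - intro; split; [assumption|]; now exists D. }
assert (HCD : ~ (C ∈ U /\ D ∈ U)).
{ intros [H1 H2].
  destruct (inter_exists hA C D) as [E HE].
  apply (uf_proper HU (uf_inter HU H1 H2 HE)).
  intros z Hz; apply HE in Hz; destruct Hz as [Hz Hz'].
  now apply HD in Hz'. }
assert (HCa : subset C a) by (intros z Hz; now apply HC in Hz).
destruct (uf_ultra HU HCa HD); tauto.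
Qed.

Lemma max_unique (A : structure) (hA : ZFC A) (d d' a b : A) :
  is_max d a b -> is_max d' b a -> d = d'.
Proof.
intros [[-> H]|[-> H]] [[-> H']|[-> H']]; auto;
  apply (subset_antisym hA); auto.
Qed.

Lemma extension_unique (A : structure) (hA : ZFC A) (d U a E E' : A) :
  is_extension E d U a -> is_extension E' d U a -> E = E'.
Proof.
intros H H'; apply (zfc_extensionality hA); intro X.
rewrite (H X), (H' X); reflexivity.
Qed.

Lemma lipschitz_lt_asym (A : structure) (hA : ZFC A) (U W : A) :
  lipschitz_lt U W -> ~ lipschitz_lt W U.
Proof.
intros [a [b [d [U' [W' [HU [HW [Hd [HU' [HW' H]]]]]]]]]].
intros [b2 [a2 [d2 [W2 [U2 [HW2 [HU2 [Hd2 [HW2' [HU2' H2]]]]]]]]]].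
(* Spaces, maximum and extensions are determined by [U] and [W], so both reductions live on the same
   [d] and can be composed. *)
rewrite (ultrafilter_space_unique hA (proj1 (proj1 (proj2 HU2)))
  (proj1 (proj1 (proj2 HU)))) in *.
rewrite (ultrafilter_space_unique hA (proj1 (proj1 (proj2 HW2)))
  (proj1 (proj1 (proj2 HW)))) in *.
rewrite <- (max_unique hA Hd Hd2) in *.
rewrite (extension_unique hA HU2' HU'), (extension_unique hA HW2' HW') in H2.
assert (Hdo : is_ordinal d).
{ destruct Hd as [[-> _]|[-> _]]; [apply HU|apply HW]. }
assert (Had : subset a d).
{ destruct Hd as [[-> _]|[-> Had]]; [|exact Had]. now intro. }
apply (lipschitz_sets_extension_irrefl hA Hdo (proj1 (proj1 (proj2 HU)))
  Had HU').
exact (lipschitz_sets_trans hA Hdo H H2).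
Qed.

(** * Ultrapowers of the universe, with functions taken in [V] *)

(** Mapping an extended environment and extending a mapped one give only pointwise equal
    environments; this bridges them without functional extensionality. *)
Lemma sat_ext (A : structure) p (e e' : nat -> A) :
  (forall n, e n = e' n) -> sat p e <-> sat p e'.
Proof.
revert e e'; induction p as [i j|i j|p IH|p IHp q IHq|p IH];
  intros e e' H; simpl.
- rewrite !H; reflexivity.
- rewrite !H; reflexivity.
- rewrite (IH e e' H); reflexivity.
- rewrite (IHp e e' H), (IHq e e' H); reflexivity.
- enough (forall x, sat p (scons x e) <-> sat p (scons x e')) by firstorder.
  intro x; apply IH; intros [|n]; simpl; auto.
Qed.

Lemma in_univ_surj (V : structure) (x : sub (@univ V)) :
  exists y, x = in_univ y.
Proof. destruct x as [x []]; now exists x. Qed.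

Lemma in_univ_inj (V : structure) (x y : V) : in_univ x = in_univ y -> x = y.
Proof. intro H; exact (f_equal (@proj1_sig _ _) H). Qed.

Lemma in_univ_elementary (V : structure) : elementary (@in_univ V).
Proof.
intro p; induction p as [i j|i j|p IH|p IHp q IHq|p IH]; intro e; simpl.
- reflexivity.
- split; [congruence|apply in_univ_inj].
- rewrite IH; reflexivity.
- rewrite IHp, IHq; reflexivity.
- assert (Hs : forall x, sat p (scons x e) <->
      sat p (scons (in_univ x) (fun n => in_univ (e n)))).
  { intro x; rewrite IH; apply sat_ext; intros [|n]; reflexivity. }
  split.
  + intros [x Hx]; exists (in_univ x); now apply Hs.
  + intros [x Hx]; destruct (in_univ_surj x) as [y ->].
    exists y; now apply Hs.
Qed.

Definition app_mem (A : structure) (f g x : A) : Prop :=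
  exists y z, app f x y /\ app g x z /\ y ∈ z.

(* [is_ultrapower] and the seed clause of [ultrapower_of] for functions taken in
   [V] itself instead of [sub (@univ V)]. *)
Record represents (V : structure) (U a : V) (M : V -> Prop)
    (j : sub (@univ V) -> sub M) (s : sub M) (rep : V -> sub M) : Prop := {
  rp_mem : forall f g, is_fun f a -> is_fun g a ->
    (rep f ∈ rep g <-> measure_one U a (app_mem f g));
  rp_onto : forall y, exists f, is_fun f a /\ rep f = y;
  rp_const : forall x f, is_const f a x -> j (in_univ x) = rep f;
  rp_seed : forall f, is_id f a -> s = rep f
}.

(** [in_univ] is an isomorphism, so representatives and measure-one sets can be moved between [V]
    and its copy as a class. *)
Lemma ultrapower_represents (V : structure) (hV : ZFC V) (U a : V)
    (M : V -> Prop) (j : sub (@univ V) -> sub M) (s : sub M) :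
  ultrafilter U a -> ultrapower_of U j s ->
  exists rep, represents U a j s rep.
Proof.
intros HU [X [rep [HX [Hrep Hs]]]].
rewrite (ultrafilter_space_unique hV HX HU) in *.
pose proof (@in_univ_elementary V) as Hel.
assert (Hfun : forall f, is_fun f a <-> is_fun (in_univ f) (in_univ a)).
{ intro f; exact (fun_elementary f a Hel). }
assert (Happ : forall f x y : V,
    app f x y <-> app (in_univ f) (in_univ x) (in_univ y)).
{ intros f x y; exact (app_elementary f x y Hel). }
exists (fun f => rep (in_univ f)); split.
- intros f g Hf Hg.
  rewrite (up_mem Hrep (proj1 (Hfun f) Hf) (proj1 (Hfun g) Hg)).
  assert (Hmem : forall x, app_mem f g x <-> exists y z,
      app (in_univ f) (in_univ x) y /\ app (in_univ g) (in_univ x) z /\ y ∈ z).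
  { intro x; split.
    - intros [y [z [Hy [Hz Hyz]]]]; exists (in_univ y), (in_univ z).
      now rewrite <- !Happ.
    - intros [y [z H]].
      destruct (in_univ_surj y) as [y' ->], (in_univ_surj z) as [z' ->].
      rewrite <- !Happ in H; now exists y', z'. }
  split.
  + intros [S [HS HSx]]; destruct (in_univ_surj S) as [S' ->].
    exists S'; split; [exact HS|]; intro x; rewrite (Hmem x).
    exact (HSx (in_univ x)).
  + intros [S [HS HSx]]; exists (in_univ S); split; [exact HS|].
    intro x; destruct (in_univ_surj x) as [x' ->]; rewrite <- (Hmem x').
    exact (HSx x').
- intro y; destruct (up_onto Hrep y) as [f [Hf Hy]].
  destruct (in_univ_surj f) as [f' ->].
  exists f'; split; [now apply Hfun|exact Hy].
- intros x f [Hf Hc]; apply (up_embed Hrep); split; [now apply Hfun|].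
  intros z y; destruct (in_univ_surj z) as [z' ->], (in_univ_surj y) as [y' ->].
  rewrite <- Happ; intro H; now rewrite (Hc z' y' H).
- intros f [Hf Hi]; apply Hs; split; [now apply Hfun|].
  intros z y; destruct (in_univ_surj z) as [z' ->], (in_univ_surj y) as [y' ->].
  rewrite <- Happ; intro H; now rewrite (Hi z' y' H).
Qed.

Lemma measure_one_and (A : structure) (hA : ZFC A) (U a : A) (P Q : A -> Prop) :
  ultrafilter U a -> measure_one U a P -> measure_one U a Q ->
  measure_one U a (fun x => P x /\ Q x).
Proof.
intros HU [S [HS HSx]] [T [HT HTx]].
destruct (inter_exists hA S T) as [C HC].
exists C; split; [exact (uf_inter HU HS HT HC)|].
intro x; rewrite (HC x), (HSx x), (HTx x); tauto.
Qed.

(** Upward closure spares computing the set where f(x) ∈ g(x): it exists by Separation and only has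
    to include a measure-one set. *)
Lemma represents_mem_intro (V : structure) (hV : ZFC V) (U a : V)
    (M : V -> Prop) (j : sub (@univ V) -> sub M) (s : sub M) (rep : V -> sub M)
    (P : V -> Prop) (f g : V) :
  ultrafilter U a -> represents U a j s rep -> is_fun f a -> is_fun g a ->
  measure_one U a P -> (forall x, x ∈ a -> P x -> app_mem f g x) ->
  rep f ∈ rep g.
Proof.
intros HU Hrep Hf Hg [S [HS HSx]] HP.
destruct (@separation V hV
  (FEx (FEx (FAnd (FApp 3 2 1) (FAnd (FApp 4 2 0) (FMem 1 0)))))
  (scons f (fun _ => g)) (app_mem f g) a) as [T HT].
{ intro z; unfold app_mem; sat_tac. }
apply (rp_mem Hrep Hf Hg); exists T; split; [|exact HT].
apply (uf_up HU HS).
- intros x Hx; apply HSx in Hx; apply HT; split; [|apply HP]; tauto.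
- intros x Hx; now apply HT in Hx.
Qed.

(** [s] is the class of the identity and j(X) that of a constant function, so membership says that x
    ∈ X for almost all x: [U] is derived from [j] and [s]. *)
Lemma seed_mem_iff (V : structure) (hV : ZFC V) (U a : V) (M : V -> Prop)
    (j : sub (@univ V) -> sub M) (s : sub M) (rep : V -> sub M) (X : V) :
  represents U a j s rep -> s ∈ j (in_univ X) <-> trace_in U a X.
Proof.
intro Hrep.
destruct (id_exists hV a) as [i [Hi Hix]].
destruct (const_exists hV a X) as [k [Hk Hkx]].
rewrite (rp_seed Hrep Hi), (rp_const Hrep Hk).
rewrite (rp_mem Hrep (proj1 Hi) (proj1 Hk)).
assert (Hmem : forall x, x ∈ a -> (app_mem i k x <-> x ∈ X)).
{ intros x Hx; split.
  - intros [y [z [Hy [Hz Hyz]]]].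
    now rewrite (proj2 Hi x y Hy), (proj2 Hk x z Hz) in Hyz.
  - intro HxX; exists x, X; auto. }
split; intros [C [HC HC']]; exists C.
- split; [|exact HC]; intro x; rewrite (HC' x).
  pose proof (Hmem x); tauto.
- split; [exact HC'|]; intro x; rewrite (HC x).
  pose proof (Hmem x); tauto.
Qed.

(** Every point below [s] is represented by some f with f(x) ∈ x almost everywhere, so transitivity
    is inherited pointwise from the ordinals x ∈ a. *)
Lemma seed_ordinal (V : structure) (hV : ZFC V) (U a : V) (M : V -> Prop)
    (j : sub (@univ V) -> sub M) (s : sub M) (rep : V -> sub M) :
  ultrafilter U a -> is_ordinal a -> represents U a j s rep -> is_ordinal s.
Proof.
intros HU Ha Hrep.
destruct (id_exists hV a) as [i [Hi Hix]].
pose proof (proj1 Hi) as Hif.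
rewrite (rp_seed Hrep Hi).
split.
- intros y Hy z Hz.
  destruct (rp_onto Hrep y) as [f [Hf <-]], (rp_onto Hrep z) as [g [Hg <-]].
  apply (rp_mem Hrep Hf Hif) in Hy; apply (rp_mem Hrep Hg Hf) in Hz.
  apply (represents_mem_intro hV HU Hrep Hg Hif (measure_one_and hV HU Hy Hz)).
  intros x Hx [[y' [x' [Hy' [Hx' Hyx]]]] [z' [y'' [Hz' [Hy'' Hzy]]]]].
  rewrite (app_functional Hf Hy'' Hy') in Hzy.
  rewrite (proj2 Hi x x' Hx') in Hyx.
  exists z', x; repeat split; auto.
  exact (proj1 (ordinal_mem Ha Hx) y' Hyx z' Hzy).
- intros y Hy z Hz w Hw.
  destruct (rp_onto Hrep y) as [f [Hf <-]], (rp_onto Hrep z) as [g [Hg <-]],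
    (rp_onto Hrep w) as [h [Hh <-]].
  apply (rp_mem Hrep Hf Hif) in Hy; apply (rp_mem Hrep Hg Hf) in Hz.
  apply (rp_mem Hrep Hh Hg) in Hw.
  apply (represents_mem_intro hV HU Hrep Hh Hf
    (measure_one_and hV HU (measure_one_and hV HU Hy Hz) Hw)).
  intros x Hx [[[y' [x' [Hy' [Hx' Hyx]]]] [z' [y'' [Hz' [Hy'' Hzy]]]]]
    [w' [z'' [Hw' [Hz'' Hwz]]]]].
  rewrite (app_functional Hf Hy'' Hy') in Hzy.
  rewrite (app_functional Hg Hz'' Hz') in Hwz.
  rewrite (proj2 Hi x x' Hx') in Hyx.
  exists w', y'; repeat split; auto.
  exact (proj1 (ordinal_mem (ordinal_mem Ha Hx) Hyx) z' Hzy w' Hwz).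
Qed.

(** * From a comparison to a strongly Lipschitz reduction *)

(** This is where internality matters. If [g] represents [n], then n ∈ i(Z) says that g(x) ∈ Z for
    D-almost all x, a condition on [Z] over M with parameters in M, so Separation in M applies. *)
Lemma internal_derived_measure (V : structure) (M N : V -> Prop)
    (i : sub M -> sub N) (s : sub M) (n : sub N) :
  internal_ultrapower_embedding i ->
  exists E : sub M, forall Z, Z ∈ E <-> subset Z s /\ n ∈ i Z.
Proof.
intros [[_ [_ [_ hM]]] [_ [_ [D [X [rep [HD Hrep]]]]]]].
destruct (up_onto Hrep n) as [g [Hg <-]].
destruct (zfc_power hM s) as [P HP].
destruct (@separation (sub M) hM
  (FEx (FAnd (FMem 0 2) (FAll (FIff (FMem 0 1) (FAnd (FMem 0 4)
    (FEx (FAnd (FApp 6 1 0) (FMem 0 3))))))))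
  (scons D (scons X (fun _ => g)))
  (fun Z => measure_one D X (fun x => exists y, app g x y /\ y ∈ Z)) P)
  as [E HE].
{ intro Z; unfold measure_one; sat_tac. }
exists E; intro Z; rewrite (HE Z), (HP Z).
apply and_iff_compat_l.
destruct (const_exists hM X Z) as [k [Hk Hkx]].
rewrite (up_embed Hrep Hk), (up_mem Hrep Hg (proj1 Hk)).
assert (Hmem : forall x, x ∈ X -> (exists y, app g x y /\ y ∈ Z) <->
    exists y z, app g x y /\ app k x z /\ y ∈ z).
{ intros x Hx; split.
  - intros [y [Hy HyZ]]; exists y, Z; auto.
  - intros [y [z [Hy [Hz Hyz]]]]; rewrite (proj2 Hk x z Hz) in Hyz.
    now exists y. }
split; intros [S [HS HSx]]; exists S; (split; [exact HS|]); intro x;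
  rewrite (HSx x); pose proof (Hmem x); tauto.
Qed.

(* The only instance of Łoś's theorem that is needed; it follows from [rp_mem]
   alone, without choice. *)
Lemma represents_inter_seed (V : structure) (hV : ZFC V) (W b : V)
    (M : V -> Prop) (j : sub (@univ V) -> sub M) (s : sub M) (rep : V -> sub M)
    (X c : V) :
  ultrafilter W b -> represents W b j s rep -> is_fun c b ->
  (forall x y, app c x y -> is_inter y X x) ->
  is_inter (rep c) (j (in_univ X)) s.
Proof.
intros HW Hrep Hc Hcx z.
destruct (id_exists hV b) as [i [Hi Hix]].
destruct (const_exists hV b X) as [k [Hk Hkx]].
rewrite (rp_seed Hrep Hi), (rp_const Hrep Hk).
destruct (rp_onto Hrep z) as [f [Hf <-]].
split.
- intro H; apply (rp_mem Hrep Hf Hc) in H; split.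
  + apply (represents_mem_intro hV HW Hrep Hf (proj1 Hk) H).
    intros x Hx [y [y' [Hy [Hy' Hyy']]]]; exists y, X; repeat split; auto.
    now apply (Hcx x y' Hy') in Hyy'.
  + apply (represents_mem_intro hV HW Hrep Hf (proj1 Hi) H).
    intros x Hx [y [y' [Hy [Hy' Hyy']]]]; exists y, x; repeat split; auto.
    now apply (Hcx x y' Hy') in Hyy'.
- intros [H H'].
  apply (rp_mem Hrep Hf (proj1 Hk)) in H; apply (rp_mem Hrep Hf (proj1 Hi)) in H'.
  apply (represents_mem_intro hV HW Hrep Hf Hc (measure_one_and hV HW H H')).
  intros x Hx [[y [X' [Hy [HX' HyX]]]] [y' [x' [Hy' [Hx' Hyx]]]]].
  rewrite (proj2 Hk x X' HX') in HyX; rewrite (proj2 Hi x x' Hx') in Hyx.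
  rewrite (app_functional Hf Hy' Hy) in Hyx.
  destruct (app_total Hc Hx) as [C HC].
  exists y, C; repeat split; auto; now apply (Hcx x C HC).
Qed.

Lemma inter_fun_exists (V : structure) (hV : ZFC V) (b X : V) :
  exists c, is_fun c b /\ forall x y, app c x y -> is_inter y X x.
Proof.
destruct (@graph_exists V hV (FInter 0 3 1) (fun _ => X)
  (fun x y => is_inter y X x) b) as [c [Hc Happ]].
- intros; sat_tac.
- intros x _; destruct (inter_exists hV X x) as [y Hy]; exists y.
  split; [exact Hy|]; intros y' Hy'; exact (inter_unique hV Hy Hy').
- exists c; split; [exact Hc|]; intros x y H; now apply Happ in H.
Qed.

Lemma extension_exists (V : structure) (hV : ZFC V) (d U a : V) :
  exists U', is_extension U' d U a.
Proof.
destruct (zfc_power hV d) as [P HP].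
destruct (@separation V hV (FEx (FAnd (FInter 0 1 2) (FMem 0 3)))
  (scons a (fun _ => U)) (trace_in U a) P) as [U' HU'].
{ intro z; unfold trace_in; sat_tac. }
exists U'; intro X; rewrite (HU' X), (HP X); reflexivity.
Qed.

(* The reduction is [X |-> {x ∈ b : X ∩ x ∈ u x}], where [u] represents the
   measure on [s1] derived from [i1] and the point [i0 s0]. *)
Lemma seed_lt_lipschitz_lt (V : structure) (hV : ZFC V) (U W : V) :
  Un U -> Un W -> seed_lt U W -> lipschitz_lt U W.
Proof.
intros [a HU] [b HW].
intros [M0 [M1 [j0 [s0 [j1 [s1 [HM0 [HM1 [N [i0 [i1 [Hcomp Hlt]]]]]]]]]]]].
destruct Hcomp as [Hi0 [Hi1 Hcomm]].
assert (HUu : ultrafilter U a) by apply HU.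
assert (HWu : ultrafilter W b) by apply HW.
destruct (ultrapower_represents hV HUu HM0) as [rep0 Hrep0].
destruct (ultrapower_represents hV HWu HM1) as [rep1 Hrep1].
destruct (internal_derived_measure s1 (i0 s0) Hi1) as [E HE].
destruct (rp_onto Hrep1 E) as [u [Hu HuE]].
destruct (ordinal_max hV (proj1 HU) (proj1 HW)) as [d [Hd Hdo]].
destruct (extension_exists hV d U a) as [U' HU'].
destruct (extension_exists hV d W b) as [W' HW'].
assert (Hbd : subset b d).
{ destruct Hd as [[-> Hd]|[-> _]]; [exact Hd|now intro]. }
assert (Hkey : forall X,
    trace_in U a X <-> measure_one W b
      (fun x => exists C v, is_inter C X x /\ app u x v /\ C ∈ v)).
{ intro X.
  rewrite <- (seed_mem_iff hV X Hrep0).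
  pose proof (proj1 (proj2 (proj2 Hi0))) as Hel0.
  pose proof (proj1 (proj2 (proj2 Hi1))) as Hel1.
  rewrite (mem_elementary s0 (j0 (in_univ X)) Hel0), Hcomm.
  destruct (inter_fun_exists hV b X) as [c [Hc Hcx]].
  pose proof (represents_inter_seed hV HWu Hrep1 Hc Hcx) as Hint.
  pose proof (proj1 (inter_elementary _ _ _ Hel1) Hint) as Hint1.
  assert (Hsub : subset (rep1 c) s1) by (intros z Hz; now apply Hint in Hz).
  (* [rep1 c] is j1(X) ∩ s1. By [Hlt] the point i0(s0) lies in i1(s1), so cutting j1(X) down to s1
     does not affect whether its image contains that point. *)
  transitivity (rep1 c ∈ E).
  { rewrite (HE (rep1 c)), (Hint1 (i0 s0)); tauto. }
  rewrite <- HuE, (rp_mem Hrep1 Hc Hu).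
  assert (Hmem : forall x, x ∈ b -> app_mem c u x <->
      exists C v, is_inter C X x /\ app u x v /\ C ∈ v).
  { intros x Hx; destruct (app_total Hc Hx) as [C HC]; split.
    - intros [C' [v [HC' H]]]; exists C', v; split; [|exact H].
      exact (Hcx x C' HC').
    - intros [C' [v [HC' H]]]; exists C', v; split; [|exact H].
      now rewrite (inter_unique hV HC' (Hcx x C HC)). }
  split; intros [S [HS HSx]]; exists S; (split; [exact HS|]); intro x;
    rewrite (HSx x); pose proof (Hmem x); tauto. }
exists a, b, d, U', W'; do 5 (split; [assumption|]).
destruct (zfc_power hV d) as [P HP].
pose (R := fun X Y => forall x, x ∈ Y <-> x ∈ b /\
  exists C v, is_inter C X x /\ app u x v /\ C ∈ v).
destruct (@graph_exists V hV
  (FAll (FIff (FMem 0 1) (FAnd (FMem 0 4)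
    (FEx (FEx (FAnd (FInter 1 4 2) (FAnd (FApp 7 2 0) (FMem 1 0))))))))
  (scons b (fun _ => u)) R P) as [f [Hf Happ]].
{ intros; unfold R; sat_tac. }
{ intros X _.
  destruct (@separation V hV
    (FEx (FEx (FAnd (FInter 1 3 2) (FAnd (FApp 4 2 0) (FMem 1 0)))))
    (scons X (fun _ => u))
    (fun x => exists C v, is_inter C X x /\ app u x v /\ C ∈ v) b) as [Y HY].
  { intro z; sat_tac. }
  exists Y; split; [exact HY|]; intros Y' HY'.
  apply (zfc_extensionality hV); intro x; rewrite (HY x), (HY' x); reflexivity. }
exists P, f; split; [exact HP|]; split; [split; [exact Hf|]|split].
- intros X Y HXY; apply Happ in HXY; destruct HXY as [_ HXY].
  apply HP; intros x Hx; apply Hbd; now apply HXY in Hx.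
- intros X Xx Y Yx x HX Hx HXx HY HYx.
  apply Happ in HY; apply Happ in HYx.
  rewrite (proj2 HY x), (proj2 HYx x); apply and_iff_compat_l.
  (* The value at [x] consults X only through X ∩ x, which is also (X ∩ x) ∩ x. *)
  enough (Heq : forall C, is_inter C X x <-> is_inter C Xx x).
  { split; intros [C [v [HC H]]]; exists C, v; (split; [|exact H]);
      now apply Heq. }
  intro C; split; intros HC z; rewrite (HC z).
  + rewrite (HXx z); tauto.
  + rewrite (HXx z); tauto.
- assert (HfX : forall X Y, app f X Y -> trace_in U a X <-> Y ∈ W').
  { intros X Y HXY; apply Happ in HXY; destruct HXY as [_ HY].
    assert (HYb : subset Y b) by (intros x Hx; now apply HY in Hx).
    rewrite (Hkey X), (HW' Y); split.
    - intros [S [HS HSx]]; split; [intros x Hx; now apply Hbd, HYb|].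
      exists S; split; [|exact HS]; intro x; rewrite (HSx x), (HY x); tauto.
    - intros [_ [S [HS HSW]]]; exists S; split; [exact HSW|].
      intro x; rewrite (HS x), (HY x); tauto. }
  intro X; rewrite (HU' X); split.
  + intros [HXd HX]; apply HP in HXd.
    destruct (app_total Hf HXd) as [Y HY]; exists Y.
    split; [exact HY|]; now apply (HfX X Y HY).
  + intros [Y [HY HYW]]; split; [apply HP; exact (app_dom Hf HY)|].
    now apply (HfX X Y HY).
Qed.

(** * Totality of the seed order on [Un] *)

Lemma trace_in_of_mem (A : structure) (U a X : A) :
  ultrafilter U a -> X ∈ U -> trace_in U a X.
Proof.
intros HU HX; exists X; split; [|exact HX].
intro z; pose proof (uf_sub HU HX (z := z)); tauto.
Qed.

Lemma mem_of_trace_in (A : structure) (hA : ZFC A) (U a X : A) :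
  subset X a -> trace_in U a X -> X ∈ U.
Proof.
intros HX [C [HC HCU]]; enough (C = X) by congruence.
apply (zfc_extensionality hA); intro z; rewrite (HC z).
pose proof (HX z); tauto.
Qed.

(** By uniformity the complement of [x] in [b] is in [W], and it is disjoint from [x]. *)
Lemma Un_on_not_trace_in (A : structure) (hA : ZFC A) (W b x : A) :
  Un_on W b -> x ∈ b -> ~ trace_in W b x.
Proof.
intros [_ [[HW _] Huniform]] Hx [C [HC HCW]].
destruct (diff_exists hA b x) as [D HD].
destruct (inter_exists hA C D) as [B HB].
apply (uf_proper HW (uf_inter HW HCW (Huniform x D Hx HD) HB)).
intros z Hz; apply HB in Hz; destruct Hz as [Hz Hz'].
apply HC in Hz; now apply HD in Hz'.
Qed.

Lemma Un_on_eq (A : structure) (hA : ZFC A) (U a W b : A) :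
  Un_on U a -> Un_on W b ->
  (forall X, trace_in U a X <-> trace_in W b X) -> U = W.
Proof.
intros HU HW Htrace.
assert (HUu : ultrafilter U a) by apply HU.
assert (HWu : ultrafilter W b) by apply HW.
(* Equal traces force equal spaces: the smaller space has measure one for its own ultrafilter, hence
   for the other, against uniformity. *)
assert (a = b) as <-.
{ destruct (ordinal_trichotomy hA (proj1 HU) (proj1 HW)) as [H|[H|H]];
    [|exact H|].
  - destruct (Un_on_not_trace_in hA HW H).
    apply Htrace, (trace_in_of_mem HUu), (uf_full HUu).
  - destruct (Un_on_not_trace_in hA HU H).
    apply Htrace, (trace_in_of_mem HWu), (uf_full HWu). }
apply (zfc_extensionality hA); intro X; split; intro HX.
- apply (mem_of_trace_in hA (uf_sub HUu HX)), Htrace.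
  exact (trace_in_of_mem HUu HX).
- apply (mem_of_trace_in hA (uf_sub HWu HX)), Htrace.
  exact (trace_in_of_mem HWu HX).
Qed.

(** The images of the two seeds under a comparison are ordinals of N, and trichotomy there decides
    the case. *)
Lemma seed_trichotomy (V : structure) (hV : ZFC V) (hUA : ultrapower_axiom V)
    (U W : V) :
  Un U -> Un W -> seed_lt U W \/ U = W \/ seed_lt W U.
Proof.
intros [a HU] [b HW].
destruct (hUA U a W b (proj1 (proj2 HU)) (proj1 (proj2 HW)))
  as [M0 [M1 [j0 [s0 [j1 [s1 [HM0 [HM1 [N [i0 [i1 Hcomp]]]]]]]]]]].
pose proof Hcomp as [Hi0 [Hi1 Hcomm]].
pose proof (proj1 (proj2 (proj2 Hi0))) as Hel0.
pose proof (proj1 (proj2 (proj2 Hi1))) as Hel1.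
assert (HUu : ultrafilter U a) by apply HU.
assert (HWu : ultrafilter W b) by apply HW.
destruct (ultrapower_represents hV HUu HM0) as [rep0 Hrep0].
destruct (ultrapower_represents hV HWu HM1) as [rep1 Hrep1].
assert (hN : ZFC (sub N)) by apply Hi0.
destruct (ordinal_trichotomy hN
  (proj1 (ordinal_elementary _ Hel0) (seed_ordinal hV HUu (proj1 HU) Hrep0))
  (proj1 (ordinal_elementary _ Hel1) (seed_ordinal hV HWu (proj1 HW) Hrep1)))
  as [H|[H|H]].
- left; exists M0, M1, j0, s0, j1, s1; do 2 (split; [assumption|]).
  now exists N, i0, i1.
(* If the seeds have the same image, both ultrafilters are derived from the common embedding into N
   and that point. *)
- right; left; apply (Un_on_eq hV HU HW); intro X.
  rewrite <- (seed_mem_iff hV X Hrep0), <- (seed_mem_iff hV X Hrep1).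
  rewrite (mem_elementary s0 (j0 (in_univ X)) Hel0).
  rewrite (mem_elementary s1 (j1 (in_univ X)) Hel1).
  rewrite H, Hcomm; reflexivity.
- right; right; exists M1, M0, j1, s1, j0, s0; do 2 (split; [assumption|]).
  exists N, i1, i0; split; [|exact H].
  split; [exact Hi1|]; split; [exact Hi0|]; now intro.
Qed.

Theorem theorem6p7 (V : structure) (hZFC : ZFC V) (hUA : ultrapower_axiom V) :
  ultrafilter_determinacy V /\
  (forall U W : V, Un U -> Un W -> (lipschitz_lt U W <-> seed_lt U W)).
Proof.
split.
- intros U W HU HW HUW.
  destruct (seed_trichotomy hZFC hUA HU HW) as [H|[H|H]]; [|tauto|].
  + left; exact (seed_lt_lipschitz_lt hZFC HU HW H).
  + right; exact (seed_lt_lipschitz_lt hZFC HW HU H).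
- intros U W HU HW; split; [|exact (seed_lt_lipschitz_lt hZFC HU HW)].
  (* Totality turns the inclusion into equality: the other two cases contradict asymmetry, whose
     diagonal instance is irreflexivity. *)
  intro H; destruct (seed_trichotomy hZFC hUA HU HW) as [H'|[<-|H']].
  + exact H'.
  + destruct (lipschitz_lt_asym hZFC H H).
  + destruct (lipschitz_lt_asym hZFC H (seed_lt_lipschitz_lt hZFC HW HU H')).
Qed.
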